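(* Let $A=A^T\in\mathbb R^{n\times n}$, let $Q\in\mathbb R^{n\times d}$ satisfy $Q^TQ=I_d$, and let $E_A(\Omega)$ denote the spectral projector of $A$ associated with a Borel set $\Omega\subset\mathbb R$. Define the scalar probability measure $\nu_Q(\Omega)=\frac1d\operatorname{tr}\bigl(Q^TE_A(\Omega)Q\bigr)$. Suppose the orthonormal polynomials $\phi_0,\ldots,\phi_k$ for $\nu_Q$ exist, with positive leading coefficients, and let $J_k$ be the $k\times k$ Jacobi matrix in their three-term recurrence. Put $$X=[\,\phi_0(A)Q\ \cdots\ \phi_{k-1}(A)Q\,],\qquad Y=\phi_k(A)Q,\qquad S=X^TX,\quad C=X^TY,\quad D=Y^TY .$$ Assume that $S$ is nonsingular. Let $e_k$ be the $k$th coordinate vector in $\mathbb R^k$. If $\beta_k$ is the final recurrence coefficient for $\phi_0,\ldots,\phi_k$ and $\mathcal B_k=\beta_k(e_k^T\otimes I_d)$, then $$AX=X(J_k\otimes I_d)+Y\mathcal B_k,$$ $$S^{-1}X^TAX=J_k\otimes I_d+S^{-1}C\mathcal B_k .$$ Let $P_X=XS^{-1}X^T$ and $Y_\perp=(I-P_X)Y$. Then $$Y_\perp^TY_\perp=D-C^TS^{-1}C .$$ Consequently, if $C=0$, every eigenvalue of $J_k$ occurs $d$ times in the block Ritz problem. The rank of the next new block is $\operatorname{rank}(D-C^TS^{-1}C)$.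
   Context: $k\ge1$. The three-term recurrence reads $x\phi_{j-1}(x)=\beta_{j-1}\phi_{j-2}(x)+\alpha_j\phi_{j-1}(x)+\beta_j\phi_j(x)$ for $1\le j\le k$ (with $\beta_0\phi_{-1}=0$), and $J_k$ is the symmetric tridiagonal matrix with diagonal $\alpha_1,\dots,\alpha_k$ and off-diagonal $\beta_1,\dots,\beta_{k-1}$; $\beta_k$ is the final recurrence coefficient. The block Ritz problem is the eigenvalue problem for the matrix $S^{-1}X^TAX$ (the Rayleigh--Ritz projection of $A$ onto $\operatorname{range}(X)$). The next new block is $Y_\perp$, the component of $Y$ orthogonal to $\operatorname{range}(X)$. *)

(* Defs.v *)
From HB Require Import structures.
From mathcomp Require Import all_boot all_order all_algebra.
From mathcomp Require Import all_classical all_reals all_analysis.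
From mathcomp.real_closed Require Import complex.
From mathcomp.real_closed Require Export mxtens.

Set Implicit Arguments.
Unset Strict Implicit.
Unset Printing Implicit Defensive.
Import Order.TTheory GRing.Theory Num.Theory.

Local Open Scope classical_set_scope.
Local Open Scope ring_scope.

Section OrthogonalProjector.
Variables (R : realFieldType) (m n : nat).
Implicit Type U : 'M[R]_(m, n).

(* Row vectors v with v U^T = 0 form the orthogonal complement of the row space
   of U, so this is the orthogonal projector onto that row space. *)
Definition orth_proj U : 'M[R]_n := proj_mx <<U>>%MS (kermx U^T).

Lemma dot_eq0 p (v : 'M[R]_(p, n)) : v *m v^T = 0 -> v = 0.
Proof.
move=> v0; apply/matrixP => i j; rewrite [RHS]mxE; apply/eqP.
have v2_ge0 l : true -> 0 <= v i l ^+ 2 by rewrite sqr_ge0.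
rewrite -sqrf_eq0; apply/eqP; apply: (psumr_eq0P v2_ge0) => //.
move/matrixP: v0 => /(_ i i); rewrite !mxE => vv0; rewrite -[RHS]vv0.
by apply: eq_bigr => l _; rewrite [v^T _ _]mxE expr2.
Qed.

Lemma cap_orth U : (<<U>> :&: kermx U^T = 0)%MS.
Proof.
apply/eqP; rewrite -submx0; set V := (_ :&: _)%MS.
have VU : (V <= U)%MS by rewrite (submx_trans (capmxSl _ _))// genmxE.
have /sub_kermxP VK : (V <= kermx U^T)%MS by exact: capmxSr.
have [W VE] := submxP VU.
by rewrite (@dot_eq0 _ V) ?sub0mx// [in X in _ *m X]VE trmx_mul mulmxA VK mul0mx.
Qed.

Lemma add_orth U : (1%:M <= <<U>> + kermx U^T)%MS.
Proof.
rewrite sub1mx -col_leq_rank.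
have := mxrank_sum_cap <<U>>%MS (kermx U^T).
rewrite cap_orth mxrank0 addn0 => ->.
by rewrite genmxE mxrank_ker mxrank_tr subnKC// rank_leq_col.
Qed.

Lemma orth_projE U : orth_proj U = orth_proj U *m (orth_proj U)^T.
Proof.
set P := orth_proj U.
have PU : (P <= U)%MS.
  by rewrite -[P]mul1mx (submx_trans (proj_mx_sub _ _ _))// genmxE.
have /sub_kermxP cP : (1%:M - P <= kermx U^T)%MS.
  by rewrite -[X in _ - X]mul1mx; apply: proj_mx_compl_sub; exact: add_orth.
have [W PE] := submxP PU.
have : (1%:M - P) *m P^T = 0 by rewrite [in P^T]PE trmx_mul mulmxA cP mul0mx.
rewrite mulmxBl mul1mx => /subr0_eq PT.
by rewrite -PT -[in LHS](trmxK P) [in LHS]PT trmx_mul trmxK.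
Qed.

End OrthogonalProjector.

Lemma mxminpoly_similar (F : fieldType) n (P M D : 'M[F]_n.+1) :
  P \in unitmx -> M = invmx P *m D *m P -> mxminpoly M = mxminpoly D.
Proof. by move=> Pu ->; rewrite -conjVmx// mxminpoly_uconj// unitmx_inv. Qed.

Section SpectralMeasure.
Variables (R : realType) (n d : nat).
Implicit Types (A : 'M[R]_n) (Q : 'M[R]_(n, d)).

(* E_A(Omega), for A symmetric: the eigenspaces of A are then pairwise
   orthogonal, and row and column eigenspaces coincide up to transposition. *)
Definition spectral_projector A (Omega : set R) : 'M[R]_n :=
  \sum_(l \in [set l | eigenvalue A l] `&` Omega) orth_proj (eigenspace A l).

Definition spectral_measure A Q (Omega : set (measurableTypeR R)) : \bar R :=
  (d%:R^-1 * \tr (Q^T *m spectral_projector A Omega *m Q))%:E.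

Lemma finite_eigenvalue A : finite_set [set l | eigenvalue A l].
Proof.
apply: contrapT => /(infinite_set_fset (size (char_poly A))) [B BA].
apply/negP; rewrite -ltnNge.
apply: max_poly_roots; rewrite ?monic_neq0 ?char_poly_monic ?finmap.fset_uniq//.
by apply/allP => x /BA /=; rewrite eigenvalue_root_char.
Qed.

Let s A : seq R := finmap.enum_fset (fset_set [set l | eigenvalue A l]).

Let spectral_projectorE A (Omega : set R) :
  spectral_projector A Omega =
  \sum_(l <- s A) (l \in Omega)%:R *: orth_proj (eigenspace A l).
Proof.
rewrite /spectral_projector fsbig_mkcondr (fsbig_finite _ _ (finite_eigenvalue A)).
by apply: eq_bigr => l _; case: ifP; rewrite ?scale1r ?scale0r.
Qed.

Let weight A Q (l : R) : R := d%:R^-1 * \tr (Q^T *m orth_proj (eigenspace A l) *m Q).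

Let weight_ge0 A Q l : 0 <= weight A Q l.
Proof.
rewrite mulr_ge0 ?invr_ge0 ?ler0n// orth_projE mulmxA -mulmxA.
rewrite -{1}(trmxK (orth_proj _)) -trmx_mul; apply: sumr_ge0 => i _.
by rewrite mxE sumr_ge0// => j _; rewrite mxE -expr2 sqr_ge0.
Qed.

Let atom A Q (i : nat) : {measure set (measurableTypeR R) -> \bar R} :=
  mscale (NngNum (weight_ge0 A Q (s A)`_i)) (dirac ((s A)`_i : measurableTypeR R)).

Let spectral_measureE A Q :
  spectral_measure A Q = msum (atom A Q) (size (s A)).
Proof.
apply/funext => Omega; rewrite /spectral_measure /msum spectral_projectorE.
rewrite mulmx_sumr mulmx_suml raddf_sum mulr_sumr -sumEFin.
rewrite (big_nth 0) big_mkord; apply: eq_bigr => i _.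
rewrite /atom/= /mscale/= /dirac indicE -EFinM; congr EFin.
by rewrite -scalemxAr -scalemxAl linearZ/= mulrCA mulrC.
Qed.

Let spectral_measure0 A Q : spectral_measure A Q set0 = 0%E.
Proof. by rewrite spectral_measureE measure0. Qed.

Let spectral_measure_ge0 A Q Omega : (0 <= spectral_measure A Q Omega)%E.
Proof. by rewrite spectral_measureE measure_ge0. Qed.

Let spectral_measure_sigma_additive A Q :
  semi_sigma_additive (spectral_measure A Q).
Proof. by rewrite spectral_measureE; exact: measure_semi_sigma_additive. Qed.

HB.instance Definition _ A Q := isMeasure.Build _ (measurableTypeR R) R
  (spectral_measure A Q) (spectral_measure0 A Q) (spectral_measure_ge0 A Q)
  (@spectral_measure_sigma_additive A Q).

Lemma eigenspace_orth A a b : A^T = A -> a != b ->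
  eigenspace A a *m (eigenspace A b)^T = 0.
Proof.
move=> Asym aDb; set U := eigenspace A a; set V := eigenspace A b.
have UA : U *m A = a *: U by exact/eigenspaceP.
have VA : V *m A = b *: V by exact/eigenspaceP.
have : a *: (U *m V^T) = b *: (U *m V^T).
  by rewrite scalemxAl -UA -mulmxA -{1}Asym -trmx_mul VA linearZ/= scalemxAr.
move=> /eqP; rewrite -subr_eq0 -scalerBl scaler_eq0 subr_eq0 (negPf aDb).
by move=> /eqP.
Qed.

Lemma sym_diagonalizable A : A^T = A ->
  exists rs, (\sum_(r <- rs) eigenspace A r :=: 1%:M)%MS.
Proof.
move=> Asym.
have [rs _ rsP] : exists2 rs, uniq rs &
    (\sum_(r <- rs) eigenspace A r :=: 1%:M)%MS; last by exists rs.
apply/diagonalizablePeigen.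
case: n A Asym => [|n'] A Asym; first by rewrite [A]thinmx0; exact: diagonalizable0.
pose c : {rmorphism R -> R[i]} := real_complex R; pose B := map_mx c A.
have Bherm : B \is hermsymmx.
  apply: realsym_hermsym; last first.
    by apply/mxOverP => i j; rewrite mxE complex_real.
  apply/is_hermitianmxP; rewrite expr0 scale1r map_mx_id//.
  by apply/matrixP => i j; rewrite !mxE -[in LHS]Asym mxE.
have /hermitian_normalmx/orthomx_spectralP BE := Bherm.
have spR := hermitian_spectral_diag_real Bherm.
pose e : 'rV[R]_n'.+1 := map_mx (@complex.Re R) (spectral_diag B).
have spE : spectral_diag B = map_mx c e.
  apply/matrixP => i j; rewrite !mxE; move/mxOverP: spR => /(_ i j).
  by move/Creal_ReP => spij; rewrite -[LHS]spij -complexRe.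
suff minE : mxminpoly A = mxminpoly (diag_mx e).
  apply/diagonalizableP; rewrite minE; apply/diagonalizableP.
  exact: diagonalizable_diag.
have minB : mxminpoly B = mxminpoly (diag_mx (spectral_diag B)).
  exact: mxminpoly_similar (spectral_unit B) BE.
apply: (map_poly_inj c); rewrite -[LHS]mxminpoly_map -[RHS]mxminpoly_map.
by rewrite map_diag_mx -spE.
Qed.

Lemma spectral_projectorT A : A^T = A -> spectral_projector A setT = 1%:M.
Proof.
move=> Asym; have [rs rsP] := sym_diagonalizable Asym.
rewrite spectral_projectorE; set T := \sum_(_ <- _) _.
have ET r : eigenspace A r *m T = eigenspace A r.
  rewrite mulmx_sumr; have [er|er] := boolP (eigenvalue A r); last first.
    rewrite negbK in er; rewrite (eqP er).
    by rewrite big1// => i _; rewrite mul0mx.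
  have rs_ : r \in s A by rewrite /s in_fset_set ?inE//; exact: finite_eigenvalue.
  rewrite (bigD1_seq r)//= ?finmap.fset_uniq// big1 ?addr0.
    rewrite in_setT scale1r proj_mx_id ?cap_orth//.
    by rewrite genmxE.
  move=> l lr; rewrite in_setT scale1r proj_mx_0 ?cap_orth//.
  by apply/sub_kermxP; apply: eigenspace_orth; rewrite // eq_sym.
suff : (1%:M <= kermx (T - 1%:M))%MS.
  by move/sub_kermxP; rewrite mul1mx => /subr0_eq.
rewrite -rsP big_seq; elim/big_ind : _ => [|U V UK VK|r _].
- exact: sub0mx.
- by rewrite addsmx_sub UK.
- by apply/sub_kermxP; rewrite mulmxBr ET mulmx1 subrr.
Qed.

Lemma spectral_measure_setT A Q : (0 < d)%N -> A^T = A -> Q^T *m Q = 1%:M ->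
  spectral_measure A Q setT = 1%E.
Proof.
move=> d0 Asym QQ; rewrite /spectral_measure spectral_projectorT// mulmx1 QQ.
by rewrite mxtrace1 mulVf// pnatr_eq0 -lt0n.
Qed.

End SpectralMeasure.

Section BlockKrylov.
Variable R : realType.

Definition orthonormal_polynomials
    (nu : {measure set (measurableTypeR R) -> \bar R}) (k : nat)
    (phi : nat -> {poly R}) : Prop :=
  [/\ forall i, (i <= k)%N -> size (phi i) = i.+1,
      forall i, (i <= k)%N -> 0 < lead_coef (phi i) &
      forall i j, (i <= k)%N -> (j <= k)%N ->
        (\int[nu]_x ((phi i).[x] * (phi j).[x])%:E = ((i == j)%:R)%:E)%E].

(* The coefficients alpha_1, ..., alpha_k and beta_1, ..., beta_k are read at the
   indices 1, ..., k; alpha 0 and beta 0 are never used. *)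
Definition three_term_recurrence (k : nat) (phi : nat -> {poly R})
    (alpha beta : nat -> R) : Prop :=
  forall j, (1 <= j <= k)%N ->
    'X * phi j.-1 = (if j == 1%N then 0 else beta j.-1 *: phi j.-2)
                    + alpha j *: phi j.-1 + beta j *: phi j.

(* Matrix indices start at 0: the diagonal is alpha_1, ..., alpha_k and the
   off-diagonals are beta_1, ..., beta_(k-1). *)
Definition jacobi_matrix (k : nat) (alpha beta : nat -> R) : 'M[R]_k :=
  \matrix_(i < k, j < k)
    (if i == j then alpha i.+1
     else if i.+1 == j :> nat then beta i.+1
     else if j.+1 == i :> nat then beta j.+1
     else 0).

(* [phi_0(A)Q ... phi_(k-1)(A)Q]: column number j * d + c is column c of
   phi_j(A)Q, which is also the ordering of the Kronecker product *t. *)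
Definition krylov_basis (n d k : nat) (A : 'M[R]_n.+1) (Q : 'M[R]_(n.+1, d))
    (phi : nat -> {poly R}) : 'M[R]_(n.+1, k * d) :=
  \matrix_(i < n.+1, l < k * d)
    (horner_mx A (phi (mxtens_unindex l).1) *m Q) i (mxtens_unindex l).2.

(* beta (e_k^T (x) I_d); the cast replaces the row dimension 1 * d by d. *)
Definition last_block_row (k d : nat) (b : R) : 'M[R]_(d, k * d) :=
  castmx (mul1n d, erefl (k * d)%N)
    (b *: ((\row_(j < k) (j.+1 == k)%:R) *t (1%:M : 'M[R]_d))).

End BlockKrylov.

(* Main.v *)
(* The spectral measure is a finite sum of atoms, so p |-> \int p is a linear form
   on polynomials.  Expanding x phi_(j-1) in the orthonormal basis gives the
   recurrence, and evaluating the recurrence at A gives the block relation.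
   When C = 0 the Ritz matrix is J_k (x) I_d.  The eigenvalues of J_k are simple:
   the beta_j are nonzero by comparing degrees, so an eigenvector of the
   tridiagonal matrix J_k is determined by its first entry.  As J_k (x) I_d is
   symmetric, algebraic and geometric multiplicities agree. *)
Require Import Defs.
From HB Require Import structures.
From mathcomp Require Import all_boot all_order all_algebra.
From mathcomp Require Import all_classical all_reals all_analysis.
From mathcomp Require Import measurable_realfun zify ring lra.

Set Implicit Arguments.
Unset Strict Implicit.
Unset Printing Implicit Defensive.
Import Order.TTheory GRing.Theory Num.Theory.
Local Open Scope ring_scope.

(** * Ranks of diagonal, Gram and Kronecker matrices *)

Lemma rank_diag_mx (F : fieldType) n (e : 'rV[F]_n) :
  \rank (diag_mx e) = (\sum_i (e ord0 i != 0%R))%N.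
Proof.
elim: n e => [|n IHn] e; first by rewrite thinmx0 mxrank0 big_ord0.
rewrite -[n.+1]/(1 + n)%N in e *.
rewrite -[e]hsubmxK diag_mx_row rank_diag_block_mx IHn big_split_ord/= big_ord1.
congr (_ + _)%N; last by apply: eq_bigr => i _; rewrite row_mxEr.
rewrite row_mxEl [X in diag_mx X]mx11_scalar.
have -> c : diag_mx (c%:M : 'rV[F]_1) = c%:M.
  by apply/matrixP => i j; rewrite !mxE !ord1.
have [->|c0] := eqVneq (lsubmx e 0 0) 0; first by rewrite raddf0 mxrank0.
by rewrite mxrank_unit// unitmxE det_scalar1 unitfE.
Qed.

(** If [K] kills [M^T *m M], then [K *m M^T] times its own transpose is zero, so [K *m M^T = 0] by
    [dot_eq0]. *)
Lemma mxrank_gram (R : realFieldType) m n (M : 'M[R]_(m, n)) :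
  \rank (M^T *m M) = \rank M.
Proof.
apply/eqP; rewrite eqn_leq mxrankS ?submxMl//=.
have : (kermx (M^T *m M) <= kermx M^T)%MS.
  set K := kermx _; have : K *m (M^T *m M) = 0 by exact: mulmx_ker.
  move=> /(congr1 (mulmx^~ K^T)); rewrite mul0mx => KM.
  by apply/sub_kermxP/dot_eq0; rewrite trmx_mul trmxK -[RHS]KM !mulmxA.
move=> /mxrankS; rewrite !mxrank_ker mxrank_tr leq_sub2lE//.
exact: rank_leq_col.
Qed.

(** Tensoring the rank normal form of [M] with the identity keeps the outer factors invertible and
    turns the partial identity of rank r into one of rank r d. *)
Lemma mxrank_tensmx1 (F : fieldType) m n d (M : 'M[F]_(m, n)) :
  \rank (M *t (1%:M : 'M[F]_d)) = (\rank M * d)%N.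
Proof.
rewrite -[in LHS](mulmx_ebase M) -[X in \rank (_ *t X)]mulmx1.
rewrite -[X in \rank (_ *t (X *m _))]mulmx1 -!tensmx_mul.
have tens_unit p (P : 'M[F]_p) : P \in unitmx -> P *t (1%:M : 'M[F]_d) \in unitmx.
  move=> Pu; have /mulmx1_unit[]// :
      (P *t (1%:M : 'M[F]_d)) *m (invmx P *t (1%:M : 'M[F]_d)) = 1%:M.
  rewrite tensmx_mul mulmxV// mulmx1; apply/matrixP => i j.
  case: (mxtens_indexP i) (mxtens_indexP j) => i' a [j' b].
  by rewrite tensmxE !mxE -natrM mulnb (can_eq (@mxtens_indexK _ _)) xpair_eqE.
rewrite mxrankMfree ?row_free_unit ?tens_unit ?row_ebase_unit//.
rewrite eqmxMfull ?row_full_unit ?tens_unit ?col_ebase_unit//.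
suff -> : pid_mx (\rank M) *t (1%:M : 'M[F]_d) =
    pid_mx (\rank M * d)%N :> 'M[F]_(m * d, n * d).
  by rewrite rank_pid_mx// leq_mul2r ?rank_leq_row ?rank_leq_col orbT.
apply/matrixP => i j; case: (mxtens_indexP i) (mxtens_indexP j) => i' a [j' b].
rewrite tensmxE !mxE /= -natrM mulnb; congr (_%:R); congr nat_of_bool.
have d_gt0 : (0 < d)%N by exact: leq_ltn_trans (leq0n a) (ltn_ord a).
(* The pair [(i', a)] has index [i' * d + a], whose quotient by [d] is [i']. *)
rewrite -[(i' * d + a < _)%N]ltn_divLR// divnMDl// divn_small// addn0.
by rewrite eq_addl_mul// xpair_eqE andbAC.
Qed.

(** * Characteristic polynomials and multiplicities for symmetric matrices *)

Lemma char_poly_diag (F : fieldType) n (e : 'rV[F]_n) :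
  char_poly (diag_mx e) = \prod_i ('X - (e 0 i)%:P).
Proof.
rewrite char_poly_trig ?diag_mx_is_trig//.
by apply: eq_bigr => i _; rewrite !mxE eqxx.
Qed.

Lemma char_poly_similar (F : fieldType) n (P M N : 'M[F]_n) :
  P \in unitmx -> P *m M = N *m P -> char_poly M = char_poly N.
Proof.
move=> Pu PM; pose P' := map_mx polyC P.
have P'u : \det P' != 0.
  by rewrite det_map_mx polyC_eq0 -unitfE -unitmxE.
apply: (mulfI P'u); rewrite -det_mulmx mulrC -det_mulmx; congr (\det _).
rewrite /char_poly_mx mulmxBr mulmxBl -!map_mxM PM.
by rewrite mul_mx_scalar mul_scalar_mx.
Qed.

Lemma sym_diagonalizable_mx (R : realType) n (M : 'M[R]_n) : M^T = M ->
  exists P e, P \in unitmx /\ P *m M = diag_mx e *m P.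
Proof.
move=> /sym_diagonalizable[rs rsP].
have [P Pu /similar_diagPex[e /(similarP Pu) PM]] : diagonalizable M.
  (* The criterion asks for a repetition-free list; [undup] does not shrink the sum of
     eigenspaces. *)
  apply/diagonalizablePeigen; exists (undup rs); rewrite ?undup_uniq//.
  apply/eqmxP; rewrite submx1 -rsP/= big_seq.
  elim/big_ind : _ => [|U V UK VK|r rrs]; first exact: sub0mx.
    by rewrite addsmx_sub UK VK.
  by rewrite (bigD1_seq r) ?mem_undup ?undup_uniq//= addsmxSl.
by exists P, e.
Qed.

(** In a diagonalizing basis both sides count the indices [i] with [e 0 i = l]. *)
Lemma mup_char_poly_sym (R : realType) n (M : 'M[R]_n) l : M^T = M ->
  mup l (char_poly M) = \rank (eigenspace M l).
Proof.
move=> /sym_diagonalizable_mx[P [e [Pu PM]]].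
rewrite (char_poly_similar Pu PM) char_poly_diag mxrank_ker.
have -> : \rank (M - l%:M) = \rank (diag_mx (e - const_mx l)).
  rewrite -(@eqmxMfull _ _ _ _ P) ?row_full_unit// mulmxBr PM mul_mx_scalar.
  rewrite -mul_scalar_mx -mulmxBl mxrankMfree ?row_free_unit//.
  by rewrite linearB/= diag_const_mx.
rewrite rank_diag_mx -(big_map (e 0) xpredT (fun y => 'X - y%:P)) mu_prod_XsubC.
(* Each index is counted either by the multiplicity or by the rank, so the two add up to [n]. *)
rewrite count_map -sum1_count big_mkcond/=; apply: (canRL (addnK _)).
rewrite -big_split/= -[RHS]card_ord -sum1_card; apply: eq_bigr => i _.
by rewrite !mxE subr_eq0; case: eqP.
Qed.

(** * Expansion in polynomials orthonormal for a linear form *)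

Section OrthonormalExpansion.
Variables (F : fieldType) (L : {poly F} -> F) (k : nat) (phi : nat -> {poly F}).
Hypothesis L_lin : linear_for *%R L.
Hypothesis size_phi : forall i, (i <= k)%N -> size (phi i) = i.+1.
Hypothesis L_phi : forall i j, (i <= k)%N -> (j <= k)%N ->
  L (phi i * phi j) = (i == j)%:R.

#[local] HB.instance Definition _ := GRing.isLinear.Build F {poly F} F *%R L L_lin.

(** Induction on [j]: a multiple [c] of [phi j] removes the top coefficient. The remainder [q]
    expands in lower [phi i], hence is orthogonal to [phi j], which forces [c = L (p * phi j)]. *)
Lemma orthonormal_expansion j (p : {poly F}) : (j <= k.+1)%N -> (size p <= j)%N ->
  p = \sum_(i < j) L (p * phi i) *: phi i.
Proof.
elim: j p => [|j IHj] p jk sp.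
  by rewrite big_ord0; apply/eqP; rewrite -size_poly_leq0.
have [c [q [sq ->]]] : exists (c : F) (q : {poly F}),
    (size q <= j)%N /\ p = q + c *: phi j.
  have phij0 : lead_coef (phi j) != 0.
    by rewrite lead_coef_eq0 -size_poly_eq0 size_phi.
  have cE : lead_coef (phi j) = (phi j)`_j by rewrite lead_coefE size_phi.
  exists (p`_j / (phi j)`_j), (p - (p`_j / (phi j)`_j) *: phi j).
  split; last by rewrite subrK.
  apply/leq_sizeP => i; rewrite leq_eqVlt => /predU1P[<-|ji].
    by rewrite coefB coefZ divfK ?subrr// -cE.
  rewrite nth_default// (leq_trans _ ji)// (leq_trans (size_polyD _ _))// geq_max.
  by rewrite sp size_polyN (leq_trans (size_scale_leq _ _))// size_phi.
have LE i : (i <= j)%N ->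
    L ((q + c *: phi j) * phi i) = L (q * phi i) + c * (j == i)%:R.
  move=> ij; rewrite mulrDl -scalerAl linearD linearZ/= L_phi//.
  exact: leq_trans ij _.
have qE := IHj _ (ltnW jk) sq.
rewrite big_ord_recr/= LE// eqxx mulr1.
have -> : L (q * phi j) = 0.
  rewrite qE mulr_suml linear_sum big1// => i _.
  rewrite -scalerAl linearZ/= L_phi ?(ltn_eqF (ltn_ord i)) ?mulr0//.
  exact: leq_trans (ltnW (ltn_ord i)) _.
rewrite add0r {1}qE; congr (_ + _); apply: eq_bigr => i _.
by rewrite LE ?(gtn_eqF (ltn_ord i)) ?mulr0 ?addr0// ltnW.
Qed.

Lemma orthonormal_low_degree j (p : {poly F}) : (j <= k)%N -> (size p <= j)%N ->
  L (p * phi j) = 0.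
Proof.
move=> jk sp; rewrite [p](orthonormal_expansion _ sp) 1?ltnW// mulr_suml.
rewrite linear_sum big1// => i _.
by rewrite -scalerAl linearZ/= L_phi ?(ltn_eqF (ltn_ord i)) ?mulr0//
  (leq_trans _ jk)// ltnW.
Qed.

(** Expand ['X * phi m] up to [phi m.+1]. The coefficient at [phi i] with [i.+1 < m] vanishes
    because ['X] can be moved onto [phi i], giving degree below [m]. *)
Lemma orthonormal_three_term m : (m < k)%N ->
  'X * phi m = (if m == 0%N then 0 else L ('X * phi m.-1 * phi m) *: phi m.-1)
     + L ('X * phi m * phi m) *: phi m + L ('X * phi m * phi m.+1) *: phi m.+1.
Proof.
move=> mk.
have sX i : (i < k)%N -> size ('X * phi i) = i.+2.
  move=> ik; rewrite mulrC size_mulX ?size_phi// 1?ltnW//.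
  by rewrite -size_poly_eq0 size_phi// ltnW.
rewrite [LHS](@orthonormal_expansion m.+2) ?sX// 2!big_ord_recr/=.
do 2![congr (_ + _)]; case: m mk => [|m] mk; first by rewrite big_ord0.
rewrite big_ord_recr/= big1 => [|i _]; last first.
  rewrite mulrAC (orthonormal_low_degree (ltnW mk)) ?scale0r//.
  rewrite sX; first exact: ltn_ord.
  by rewrite (ltn_trans (ltn_ord i))// ltnW.
(* Moving ['X] across also identifies the lower coefficient with the upper one of the previous step,
   whence a symmetric Jacobi matrix. *)
by rewrite add0r [in LHS]mulrAC.
Qed.

End OrthonormalExpansion.

(** * Integration against the spectral measure *)

Section SpectralIntegral.
Variables (R : realType) (n d : nat) (A : 'M[R]_n) (Q : 'M[R]_(n, d)).
Local Open Scope classical_set_scope.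
Let nu := spectral_measure A Q.
Let s := finmap.enum_fset (fset_set [set l | eigenvalue A l]).

Lemma spectral_measure_sum (Omega : set (measurableTypeR R)) :
  spectral_measure A Q Omega =
  (\sum_(l <- s) spectral_measure A Q [set l] * \d_l Omega)%E.
Proof.
rewrite {1}/spectral_measure /spectral_projector fsbig_mkcondr.
rewrite (fsbig_finite _ _ (finite_eigenvalue A))/=.
rewrite mulmx_sumr mulmx_suml raddf_sum mulr_sumr -sumEFin.
rewrite big_seq [RHS]big_seq; apply: eq_bigr => l.
rewrite in_fset_set ?inE//=; last exact: finite_eigenvalue.
move=> Al; rewrite /spectral_measure /spectral_projector.
have -> : [set l0 | eigenvalue A l0] `&` [set l] = [set l].
  by apply/seteqP; split => [x []|x ->]//.
rewrite fsbig_set1 diracE -EFinM; case: ifP => _; first by rewrite mulr1.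
by rewrite mulr0 mulmx0 mul0mx linear0 mulr0.
Qed.

(** Termwise integration over point masses holds first for nonnegative integrands; a signed [f] is
    split into positive and negative parts, whose integrals are finite. *)
Lemma integral_spectral_measure (f : measurableTypeR R -> R) :
  measurable_fun setT f ->
  (\int[nu]_x (f x)%:E = (\sum_(l <- s) fine (nu [set l]) * f l)%:E)%E.
Proof.
pose w l : {nonneg R} := NngNum (fine_ge0 (measure_ge0 nu [set l])).
pose m i : {measure set (measurableTypeR R) -> \bar R} :=
  mscale (w s`_i) (dirac (s`_i : measurableTypeR R)).
have nuE (Omega : set (measurableTypeR R)) : nu Omega = msum m (size s) Omega.
  rewrite /nu/= spectral_measure_sum /msum (big_nth 0) big_mkord.
  by apply: eq_bigr.
have ge0 (g : measurableTypeR R -> \bar R) : measurable_fun setT g ->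
    (forall x, 0 <= g x)%E ->
    (\int[nu]_x g x = \sum_(l <- s) (fine (nu [set l]))%:E * g l)%E.
  move=> mg g0; rewrite (eq_measure_integral (msum m (size s)))//.
  rewrite ge0_integral_measure_sum// (big_nth 0) big_mkord.
  apply: eq_bigr => i _; rewrite ge0_integral_mscale//.
  by rewrite integral_dirac// diracT mul1e.
move=> mf; have mF : measurable_fun setT (EFin \o f) by exact/measurable_EFinP.
rewrite integralE ge0//; last exact: measurable_funepos.
rewrite ge0//; last exact: measurable_funeneg.
have fpE l : (EFin \o f)^\+%E l = (Num.max (f l) 0)%:E.
  by rewrite funeposE/= EFin_max.
have fnE l : (EFin \o f)^\-%E l = (Num.max (- f l) 0)%:E.
  by rewrite funenegE/= EFin_max.
under eq_bigr do rewrite fpE -EFinM.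
under [X in (_ - X)%E]eq_bigr do rewrite fnE -EFinM.
rewrite !sumEFin -EFinB -sumrB; congr EFin; apply: eq_bigr => l _.
rewrite -mulrBr; congr *%R.
by case: (leP (f l) 0) => fl; case: leP => fl'; lra.
Qed.

End SpectralIntegral.

(** * Nonvanishing of the recurrence coefficients *)

Section Recurrence.
Variables (R : realType) (k : nat) (phi : nat -> {poly R}) (alpha beta : nat -> R).
Hypothesis size_phi : forall i, (i <= k)%N -> size (phi i) = i.+1.
Hypothesis rec : three_term_recurrence k phi alpha beta.

(** With [beta j = 0] the right side of the recurrence has degree below [j], while ['X * phi j.-1]
    has degree [j]. *)
Lemma recurrence_beta_neq0 j : (1 <= j <= k)%N -> beta j != 0.
Proof.
case: j => // j jk; apply/eqP => b0; have := rec jk; rewrite b0 scale0r addr0/= => E.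
have sX : size ('X * phi j) = j.+2.
  rewrite mulrC size_mulX ?size_phi// 1?ltnW//.
  by rewrite -size_poly_eq0 size_phi// ltnW.
have : (size ('X * phi j)%R <= j.+1)%N.
  rewrite E (leq_trans (size_polyD _ _))// geq_max; apply/andP; split.
    case: j jk {E sX b0} => [|j] jk; first by rewrite size_poly0.
    by rewrite (leq_trans (size_scale_leq _ _))// size_phi// ltnW// ltnW.
  by rewrite (leq_trans (size_scale_leq _ _))// size_phi// ltnW.
by rewrite sX ltnn.
Qed.

End Recurrence.

(** * Columns and eigenspaces of the Jacobi matrix *)

Section JacobiMatrix.
Variables (R : realType) (k : nat) (alpha beta : nat -> R).
Let J := jacobi_matrix k alpha beta.

Lemma jacobi_matrix_sym : J^T = J.
Proof.
apply/matrixP => i j; rewrite !mxE eq_sym; case: eqVneq => [->//|ij].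
by case: eqVneq => [ji|_]; case: eqVneq => // ij'; lia.
Qed.

(** Module-valued [F] lets one column formula serve both the polynomials [phi] and the entries of an
    eigenvector. *)
Lemma sum_jacobi_matrix (V : lmodType R) (F : nat -> V) (j : 'I_k) :
  \sum_(i < k) J i j *: F i =
    (if j == 0%N :> nat then 0 else beta j *: F j.-1) + alpha j.+1 *: F j
    + (if (j.+1 < k)%N then beta j.+1 *: F j.+1 else 0).
Proof.
have JE i : J i j *: F i = (if i.+1 == j :> nat then beta j *: F j.-1 else 0)
    + (if i == j :> nat then alpha j.+1 *: F j else 0)
    + (if i == j.+1 :> nat then beta j.+1 *: F j.+1 else 0).
  rewrite !mxE -!val_eqE/=; case: (eqVneq (val i) (val j)) => [->|ij].
    by rewrite gtn_eqF// ltn_eqF// addr0 add0r.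
  rewrite addr0; case: (eqVneq i.+1 (val j)) => [<-|ij1].
    by rewrite ltn_eqF ?addr0// ltnW.
  by rewrite add0r eq_sym; case: eqVneq => [->|_]; rewrite ?scale0r.
under eq_bigr do rewrite JE.
rewrite !big_split/= -!big_mkcond/=; congr (_ + _ + _).
- case: eqVneq => [j0|]; first by rewrite big_pred0// => i; rewrite j0.
  rewrite -lt0n => j0; have jk : (j.-1 < k)%N by rewrite (leq_ltn_trans (leq_pred _)).
  by rewrite (big_pred1 (Ordinal jk))// => i;
    rewrite /= -val_eqE/= -{1}(prednK j0) eqSS.
- by rewrite (big_pred1 j).
- case: ifP => [jk|/negbT]; first by rewrite (big_pred1 (Ordinal jk)).
  rewrite -leqNgt => kj; rewrite big_pred0// => i.
  by apply/ltn_eqF/(leq_trans (ltn_ord i)).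
Qed.

(** The first coordinate, taken by [c], is injective on the eigenspace: once it is zero, the columns
    of [v *m J = l *: v] make the later entries vanish one by one. *)
Lemma rank_eigenspace_jacobi l :
  (forall j, (1 <= j < k)%N -> beta j != 0) -> (\rank (eigenspace J l) <= 1)%N.
Proof.
move=> b0; have [k0|k_gt0] := posnP k.
  by rewrite (leq_trans (rank_leq_row _)) ?k0.
pose o : 'I_k := Ordinal k_gt0; pose c : 'cV[R]_k := delta_mx o 0.
rewrite -(mxrank_mul_ker _ c).
suff -> : (eigenspace J l :&: kermx c = 0)%MS by rewrite mxrank0 addn0 rank_leq_col.
apply/eqP; rewrite -submx0; apply/row_subP => i; set v := row i _.
have vE : v *m J = l *: v.
  by apply/eigenspaceP; exact: submx_trans (row_sub _ _) (capmxSl _ _).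
have v0 : v 0 o = 0.
  have /sub_kermxP/matrixP/(_ 0 0) : (v <= kermx c)%MS.
    exact: submx_trans (row_sub _ _) (capmxSr _ _).
  by rewrite -colE !mxE.
(* Extension of [v] by zero to all of [nat], as the column formula requires. *)
pose F m : R^o := if insub m is Some j then v 0 j else 0.
have FE (j : 'I_k) : F j = v 0 j by rewrite /F valK.
suff F0 m : F m = 0 by rewrite submx0; apply/eqP/rowP => j; rewrite -FE F0 mxE.
elim/ltn_ind: m => m IHm; rewrite /F; case: insubP => // j _ jm.
case: m IHm jm => [|m] IHm jm.
  by rewrite -[RHS]v0; congr (v 0 _); apply: val_inj; rewrite jm.
have mk : (m.+1 < k)%N by rewrite -jm ltn_ord.
(* Column [m] expresses [beta m.+1 *: F m.+1] through entries already known to vanish. *)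
have := sum_jacobi_matrix F (Ordinal (ltnW mk)); rewrite /= mk.
have -> : \sum_(i0 < k) J i0 (Ordinal (ltnW mk)) *: F i0 = l * F m.
  move/rowP: vE => /(_ (Ordinal (ltnW mk))).
  rewrite [X in X = _]mxE [X in _ = X]mxE -FE => <-.
  by apply: eq_bigr => i0 _; rewrite FE mulrC.
rewrite (IHm m)// scaler0 mulr0 addr0.
have -> : (if m == 0%N then 0 else beta m *: F m.-1) = 0.
  by case: eqP => // m0; rewrite IHm ?scaler0//; lia.
rewrite add0r => /esym/eqP; rewrite scaler_eq0 (negPf (b0 _ _))//= => /eqP.
by rewrite -jm FE.
Qed.

End JacobiMatrix.

(** * Kronecker indexing and the block recurrence *)

Lemma krylov_basisE (R : realType) n d k (A : 'M[R]_n.+1) (Q : 'M[R]_(n.+1, d))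
    phi i (j : 'I_k) (c : 'I_d) :
  krylov_basis k A Q phi i (mxtens_index (j, c)) = (horner_mx A (phi j) *m Q) i c.
Proof. by rewrite mxE mxtens_indexK. Qed.

Lemma last_block_rowE (R : realType) k d (b : R) (a : 'I_d) (j : 'I_k) (c : 'I_d) :
  last_block_row k d b a (mxtens_index (j, c)) = b * (j.+1 == k)%:R * (a == c)%:R.
Proof.
rewrite castmxE cast_ord_id mxE -mulrA; congr (_ * _).
have -> : cast_ord (esym (mul1n d)) a = mxtens_index (ord0, a).
  by apply: val_inj; rewrite /= mul0n add0n.
by rewrite tensmxE !mxE.
Qed.

Lemma mulmx_tensmx1E (R : comPzRingType) m k d p (X : 'M[R]_(m, k * d))
    (M : 'M[R]_(k, p)) i j (c : 'I_d) :
  (X *m (M *t (1%:M : 'M[R]_d))) i (mxtens_index (j, c)) =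
  \sum_(a < k) X i (mxtens_index (a, c)) * M a j.
Proof.
rewrite mxE (reindex (@mxtens_index k d))/=; last first.
  by exists (@mxtens_unindex k d) => x _; rewrite ?mxtens_indexK ?mxtens_unindexK.
pose G a b := X i (mxtens_index (a, b)) * (M a j * (1%:M : 'M[R]_d) b c).
transitivity (\sum_a \sum_b G a b).
  by rewrite pair_bigA; apply: eq_bigr => -[a b] _; rewrite /G tensmxE.
apply: eq_bigr => a _; rewrite /G (bigD1 c)//= big1 ?addr0 => [|b bc].
  by rewrite mxE eqxx mulr1.
by rewrite [X in _ * (_ * X)]mxE (negPf bc) mulr0n !mulr0.
Qed.

(** Column [(j, c)] is the recurrence for ['X * phi j], evaluated at [A] and applied to column [c]
    of [Q]. *)
Lemma block_recurrence (R : realType) n d k (A : 'M[R]_n.+1) (Q : 'M[R]_(n.+1, d))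
    phi alpha beta : three_term_recurrence k phi alpha beta ->
  A *m krylov_basis k A Q phi =
    krylov_basis k A Q phi *m (jacobi_matrix k alpha beta *t (1%:M : 'M[R]_d))
    + (horner_mx A (phi k) *m Q) *m last_block_row k d (beta k).
Proof.
move=> rec; apply/matrixP => i l; case: (mxtens_indexP l) => j c.
(* Only for the last [j] does the recurrence leave the span of [phi 0], ..., [phi k.-1]; the
   indicator becomes the last block row. *)
have XE : 'X * phi j = \sum_(i < k) jacobi_matrix k alpha beta i j *: phi i
    + (j.+1 == k)%:R *: (beta k *: phi k).
  rewrite sum_jacobi_matrix (rec j.+1) ?ltn_ord//= eqSS -[RHS]addrA.
  congr (_ + _); have := ltn_ord j; rewrite leq_eqVlt => /predU1P[jk|jk].
    by rewrite jk ltnn eqxx scale1r add0r.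
  by rewrite jk ltn_eqF// scale0r addr0.
transitivity ((A *m horner_mx A (phi j) *m Q) i c).
  rewrite -mulmxA mxE [RHS]mxE; apply: eq_bigr => m _.
  by rewrite krylov_basisE.
have -> : A *m horner_mx A (phi j) = horner_mx A ('X * phi j).
  by rewrite rmorphM/= horner_mx_X.
rewrite XE raddfD raddf_sum/= mulmxDl mulmx_suml [LHS]mxE summxE [RHS]mxE.
congr (_ + _).
  rewrite mulmx_tensmx1E; apply: eq_bigr => a _.
  by rewrite krylov_basisE linearZ/= -scalemxAl mxE mulrC.
rewrite [RHS]mxE (bigD1 c)//= big1 ?addr0 => [|a ac].
  by rewrite last_block_rowE eqxx mulr1 !linearZ/= -!scalemxAl
    !mxE mulrC -mulrA mulrCA mulrA.
by rewrite last_block_rowE (negPf ac) !mulr0.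
Qed.

(** Subtracting [l] commutes with tensoring by the identity, so [mxrank_tensmx1] applies to
    [M - l%:M]. *)
Lemma eigenspace_tensmx1 (F : fieldType) k d (M : 'M[F]_k) l :
  \rank (eigenspace (M *t (1%:M : 'M[F]_d)) l) = (\rank (eigenspace M l) * d)%N.
Proof.
rewrite /eigenspace !mxrank_ker mulnBl -mxrank_tensmx1; congr (_ - \rank _)%N.
apply/matrixP => i j; case: (mxtens_indexP i) (mxtens_indexP j) => i' a [j' b].
rewrite [RHS]tensmxE [LHS]mxE tensmxE !mxE (can_eq (@mxtens_indexK _ _)) xpair_eqE.
by case: (i' == j'); case: (a == b);
  rewrite /= ?mulr1n ?mulr0n ?mulr1 ?mulr0 ?subr0 ?oppr0 ?addr0.
Qed.

(** Written as a finite sum over eigenvalues, integration is a linear form [L] on all polynomials,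
    to which the algebraic expansion applies. *)
Lemma recurrence_exists (R : realType) n d k (A : 'M[R]_n) (Q : 'M[R]_(n, d)) phi :
  orthonormal_polynomials (spectral_measure A Q) k phi ->
  exists alpha beta, three_term_recurrence k phi alpha beta.
Proof.
move=> [sphi _ ophi].
pose s := finmap.enum_fset (fset_set [set l | eigenvalue A l]%classic).
pose L (p : {poly R}) : R :=
  \sum_(l <- s) fine (spectral_measure A Q [set l]%classic) * p.[l].
have Llin : linear_for *%R L.
  move=> c p q; rewrite /L mulr_sumr -big_split/=; apply: eq_bigr => l _.
  by rewrite hornerD hornerZ; ring.
have Lphi i j : (i <= k)%N -> (j <= k)%N -> L (phi i * phi j) = (i == j)%:R.
  move=> ik jk; apply: EFin_inj; rewrite -(ophi _ _ ik jk) /L.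
  under eq_integral do rewrite -hornerM.
  by rewrite integral_spectral_measure//; exact: measurable_poly.
(* The coefficients are the integrals of [x phi_(j-1)^2] and [x phi_(j-1) phi_j]. *)
exists (fun j => L ('X * phi j.-1 * phi j.-1)), (fun j => L ('X * phi j.-1 * phi j)).
by move=> [//|j] /= jk; rewrite [LHS](orthonormal_three_term Llin sphi Lphi jk).
Qed.

(** Since [X^T *m Yp = 0], the left factor [Yp^T] may be replaced by [Y^T]; expanding the right
    factor then gives the Schur complement. *)
Lemma schur_complement_gram (R : realType) n p q (X : 'M[R]_(n, p)) (Y : 'M[R]_(n, q)) :
  let S := X^T *m X in
  let Yp := (1%:M - X *m invmx S *m X^T) *m Y in
  S \in unitmx ->
  Yp^T *m Yp = Y^T *m Y - (X^T *m Y)^T *m invmx S *m (X^T *m Y).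
Proof.
move=> S Yp Su; have XYp : X^T *m Yp = 0.
  by rewrite mulmxA mulmxBr mulmx1 !mulmxA mulmxV// mul1mx subrr mul0mx.
rewrite {1}/Yp mulmxBl mul1mx linearB/= mulmxBl.
have -> : (X *m invmx S *m X^T *m Y)^T *m Yp = 0.
  by rewrite -!mulmxA trmx_mul -mulmxA XYp mulmx0.
by rewrite subr0 /Yp mulmxBl mul1mx mulmxBr trmx_mul trmxK !mulmxA.
Qed.

(** * The block Ritz problem and the next block *)

Theorem proposition8 (R : realType) (n d k : nat) (A : 'M[R]_n.+1)
    (Q : 'M[R]_(n.+1, d)) (phi : nat -> {poly R})
    (d_gt0 : (0 < d)%N) (k_gt0 : (0 < k)%N)
    (A_sym : A^T = A) (Q_orth : Q^T *m Q = 1%:M)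
    (phi_orth : orthonormal_polynomials (spectral_measure A Q) k phi) :
  let X := krylov_basis k A Q phi in
  let Y := horner_mx A (phi k) *m Q in
  let S := X^T *m X in
  let C := X^T *m Y in
  let D := Y^T *m Y in
  let P_X := X *m invmx S *m X^T in
  let Yperp := (1%:M - P_X) *m Y in
  let ritz := invmx S *m X^T *m A *m X in
  S \in unitmx ->
  (exists alpha beta : nat -> R, three_term_recurrence k phi alpha beta) /\
  (forall alpha beta : nat -> R, three_term_recurrence k phi alpha beta ->
    let J := jacobi_matrix k alpha beta in
    let B := last_block_row k d (beta k) in
    [/\ A *m X = X *m (J *t (1%:M : 'M[R]_d)) + Y *m B,
        ritz = J *t (1%:M : 'M[R]_d) + invmx S *m C *m B,
        Yperp^T *m Yperp = D - C^T *m invmx S *m C,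
        C = 0 -> forall l : R, eigenvalue J l ->
          mup l (char_poly ritz) = d /\ \rank (eigenspace ritz l) = d &
        \rank Yperp = \rank (D - C^T *m invmx S *m C)]).
Proof.
move=> X Y S C D P_X Yperp ritz Su; split; first exact: recurrence_exists phi_orth.
move=> alpha beta rec J B.
have AX : A *m X = X *m (J *t (1%:M : 'M[R]_d)) + Y *m B by exact: block_recurrence.
have ritzE : ritz = J *t (1%:M : 'M[R]_d) + invmx S *m C *m B.
  (* [invmx S *m X^T] is a left inverse of [X]; it is applied to the block recurrence. *)
  rewrite /ritz -mulmxA AX mulmxDr mulmxA; congr (_ + _); last by rewrite !mulmxA.
  by rewrite -[X in X *m _]mulmxA mulVmx// mul1mx.
have YY := schur_complement_gram Y Su.
split => //; last by rewrite -YY mxrank_gram.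
move=> C0 l Jl; have {}ritzE : ritz = J *t (1%:M : 'M[R]_d).
  by rewrite ritzE C0 mulmx0 mul0mx addr0.
have [size_phi _ _] := phi_orth.
(* At least one because [l] is an eigenvalue, at most one because the off-diagonal entries are
   nonzero. *)
have rkJ : \rank (eigenspace J l) = 1%N.
  apply/eqP; rewrite eqn_leq lt0n mxrank_eq0; apply/andP; split; last exact: Jl.
  apply: rank_eigenspace_jacobi => j /andP[j0 jk].
  by rewrite (recurrence_beta_neq0 size_phi rec)// j0 ltnW.
have rk : \rank (eigenspace ritz l) = d by rewrite ritzE eigenspace_tensmx1 rkJ mul1n.
split => //; rewrite mup_char_poly_sym// ritzE trmx_tens jacobi_matrix_sym.
by rewrite trmx1.
Qed.
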